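(* Let $I\subset\mathbb{R}$ be an interval with interior $I^{\circ}$, let $f:I\to\mathbb{R}$ be twice differentiable on $I^{\circ}$, let $a,b\in I^{\circ}$ with $a<b$, and suppose $f''\in L_1[a,b]$. Let $c,y,d$ be real numbers with $0\le c\le y\le d\le 1$ and $0<y<1$. Let $q\ge1$ and write $\frac1p=1-\frac1q$ (so $\frac1p=0$ when $q=1$). If $|f''|^q$ is convex on $[a,b]$, then $$\left|\frac{(c-y)^2-(d-y)^2}{2}(a-b)f'(ya+(1-y)b)+\frac{(d-1)^2f'(a)-c^2f'(b)}{2}(a-b)+(c-d)f(ya+(1-y)b)+\bigl[(d-1)f(a)-cf(b)\bigr]+\frac{1}{b-a}\int_a^b f(x)\,dx\right|$$ $$\le\frac{(b-a)^2}{6}\left\{\left(c^3-(c-y)^3\right)^{1/p}\left(\frac{M|f''(a)|^q+N|f''(b)|^q}{4}\right)^{1/q}+\left((d-y)^3-(d-1)^3\right)^{1/p}\left(\frac{P|f''(a)|^q+Q|f''(b)|^q}{4}\right)^{1/q}\right\},$$ where $$M=c^4-(c-y)^3(c+3y),\qquad N=4c^3-c^4+(c-y)^3(c+3y-4),$$ $$P=(d-y)^3(d+3y)-(d-1)^3(d+3),\qquad Q=(d-y)^3(4-d-3y)+(d-1)^4.$$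
   Context: $L_1[a,b]$ denotes the space of Lebesgue integrable functions on $[a,b]$. *)

(* Defs.v *)
From mathcomp Require Import all_boot all_order all_algebra.

(* Main.v *)
Require Import Defs.
From mathcomp Require Import all_boot all_order all_algebra.
From mathcomp Require Import all_classical all_reals all_analysis.
From mathcomp Require Import ring lra.
Import Order.TTheory GRing.Theory Num.Theory.
Import numFieldNormedType.Exports.
Local Open Scope classical_set_scope.
Local Open Scope ring_scope.

(** Put t(x) = (b - x) / (b - a), so that x = t a + (1 - t) b, and let F be an
    antiderivative of f.  Integrating the kernel (t - e)^2 / 2 twice by parts
    against the second derivative of t |-> f (t a + (1 - t) b) gives an explicit
    function of x ([peano_primitive]) whose derivative at every point is
    - (b - a) (t - e)^2 / 2 f''(x).  With z = y a + (1 - y) b, the quantity to be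
    bounded is exactly the increment of this function for e = c between b and z
    plus its increment for e = d between z and a.

    Each increment is estimated with no integral of f'', by comparing
    derivatives.  Convexity gives |f''(x)|^q <= t U + (1 - t) V with
    U = |f''(a)|^q and V = |f''(b)|^q.  Since w |-> w^(1/q) is concave, it lies
    below each of its tangents w |-> alpha + beta w, so
    |f''(x)| <= alpha + beta (t U + (1 - t) V), and the derivative of
    [peano_primitive] is dominated by a polynomial in t whose primitive is
    explicit ([majorant_primitive]).  The mean value inequality
    ([norm_increment_le]) then bounds the increment by
    (b - a)^2 / 6 * (A alpha + beta B), where A and B are, up to normalization,
    the integrals of (t - e)^2 and of (t - e)^2 (t U + (1 - t) V).

    The tangent at B / A, the weighted mean of t U + (1 - t) V, makes
    A alpha + beta B equal to A^(1 - 1/q) B^(1/q): this choice plays the part of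
    the Hoelder inequality ([holder_by_tangent]). *)

(** * Comparing increments through derivatives *)

Lemma ge0_derive_le (R : realType) (h h' : R -> R) (u v : R) : u <= v ->
  (forall x, x \in `[u, v] -> is_derive x 1 h (h' x)) ->
  (forall x, x \in `]u, v[ -> 0 <= h' x) -> h u <= h v.
Proof.
move=> uv dh h0; have [<-//|uvn] := eqVneq u v.
have uv' : u < v by rewrite lt_neqAle uvn.
have dho x : x \in `]u, v[ -> is_derive x 1 h (h' x).
  by move=> xuv; apply: dh; exact: (subset_itv_oo_cc xuv).
have ch : {within `[u, v], continuous h}.
  by apply: derivable_within_continuous => x xuv; have [] := dh _ xuv.
have [w wuv hw] := @MVT R h h' u v uv' dho ch.
by rewrite -subr_ge0 hw mulr_ge0 ?h0// subr_ge0.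
Qed.

Lemma norm_increment_le (R : realType) (f g f' g' : R -> R) (u v : R) :
  u <= v ->
  (forall x, x \in `[u, v] -> is_derive x 1 f (f' x)) ->
  (forall x, x \in `[u, v] -> is_derive x 1 g (g' x)) ->
  (forall x, x \in `]u, v[ -> `|f' x| <= g' x) ->
  `|f v - f u| <= g v - g u.
Proof.
move=> uv df dg fg.
have fg' x : x \in `]u, v[ -> - g' x <= f' x <= g' x.
  by move=> /fg; rewrite ler_norml.
have h1 : g u + f u <= g v + f v.
  apply: (@ge0_derive_le _ (fun x => g x + f x) (fun x => g' x + f' x)) => // x xuv.
    by apply: is_deriveD; [exact: dg|exact: df].
  by have /andP[] := fg' _ xuv; lra.
have h2 : g u - f u <= g v - f v.
  apply: (@ge0_derive_le _ (fun x => g x - f x) (fun x => g' x - f' x)) => // x xuv.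
    by apply: is_deriveB; [exact: dg|exact: df].
  by have /andP[] := fg' _ xuv; lra.
by rewrite ler_norml; apply/andP; split; lra.
Qed.

(** * The Hoelder bound from a tangent line *)

(** The graph of w |-> w^r lies below its tangent at s: this is the weighted
    arithmetic-geometric inequality x^r s^(1-r) <= r x + (1 - r) s, which the
    convexity of the exponential gives between ln x - ln s and 0. *)
Lemma powR_tangent (R : realType) (r s x : R) : 0 < r -> r <= 1 -> 0 < s -> 0 <= x ->
  x `^ r <= s `^ r * (1 - r) + s `^ r / s * r * x.
Proof.
move=> r0 r1 s0; rewrite le_eqVlt => /predU1P[<-|x0].
  by rewrite mulr0 addr0 powR0 ?gt_eqF// mulr_ge0 ?powR_ge0// subr_ge0.
have := convex_expR (Itv01 (ltW r0) r1) (ln x - ln s) 0.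
rewrite !convRE /= mulr0 addr0 expR0 mulr1 expRD expRN !lnK ?posrE// => h.
have -> : s `^ r * (1 - r) + s `^ r / s * r * x = s `^ r * (r * (x / s) + (1 - r)).
  by field; rewrite gt_eqF.
have -> : x `^ r = s `^ r * expR (r * (ln x - ln s)).
  rewrite mulrBr expRD expRN /powR !gt_eqF// mulrCA divff ?mulr1//.
  by rewrite gt_eqF// expR_gt0.
by rewrite ler_wpM2l// powR_ge0.
Qed.

(** If A is the mass of a weight and B the integral of a nonnegative function w
    against it, then A alpha + beta B is the integral of alpha + beta w, and the
    last equality is the Hoelder bound for the integral of w^r.  The line is the
    tangent at the mean B / A. *)
Lemma holder_by_tangent (R : realType) (r A B : R) : 0 < r -> r <= 1 -> 0 < A -> 0 < B ->
  exists alpha beta : R, [/\ 0 <= beta,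
    forall x, 0 <= x -> x `^ r <= alpha + beta * x &
    A * alpha + beta * B = A `^ (1 - r) * B `^ r].
Proof.
move=> r0 r1 A0 B0; pose s := B / A; have s0 : 0 < s by exact: divr_gt0.
exists (s `^ r * (1 - r)), (s `^ r / s * r); split.
- by rewrite !mulr_ge0 ?powR_ge0 ?invr_ge0 ?ltW.
- by move=> x; exact: powR_tangent.
- have sA : B = s * A by rewrite /s divfK ?gt_eqF.
  rewrite sA powRM ?ltW// [RHS]mulrCA -powRD (subrK r 1) ?powRr1 ?ltW//; last by rewrite gt_eqF ?implybT.
  by field; rewrite gt_eqF.
Qed.

(** * Primitives of the weighted second derivative and of its majorant *)

(** Two integrations by parts of the kernel (t - e)^2 / 2, written in the variable
    x, where F stands for an antiderivative of f. *)
Definition peano_primitive {R : realType} (f F : R -> R) (a b e x : R) : R :=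
  let t := (b - x) / (b - a) in
  - ((b - a) * (t - e) ^+ 2 / 2 * derive1 f x) - (t - e) * f x - F x / (b - a).

Lemma is_derive_peano_primitive (R : realType) (f F : R -> R) (a b e x : R) :
  a < b -> is_derive x 1 F (f x) ->
  derivable f x 1 -> derivable (derive1 f) x 1 ->
  is_derive x 1 (peano_primitive f F a b e)
    (- ((b - a) * ((b - x) / (b - a) - e) ^+ 2 / 2 * derive1n 2 f x)).
Proof.
move=> ab dF /derivableP; rewrite -derive1E => df /derivableP.
rewrite -derive1E => df'.
have ba0 : b - a != 0 by rewrite subr_eq0 gt_eqF.
rewrite /peano_primitive /=; apply: is_derive_eq; rewrite /GRing.scale /=.
by field.
Qed.

(** Here A / 3, m / 12 and (4 * A - m) / 12 are primitives in t of (t - e)^2,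
    (t - e)^2 t and (t - e)^2 (1 - t).  The minus sign comes from t decreasing
    in x. *)
Definition majorant_primitive {R : realType} (a b e alpha beta U V x : R) : R :=
  let t := (b - x) / (b - a) in
  let A := (t - e) ^+ 3 in
  let m := (t - e) ^+ 3 * (3 * t + e) in
  - ((b - a) ^+ 2 / 6 *
     (A * alpha + beta * ((m * U + (4 * A - m) * V) / 4))).

Lemma is_derive_majorant_primitive (R : realType)
    (a b e alpha beta U V x : R) : a < b ->
  let t := (b - x) / (b - a) in
  is_derive x 1 (majorant_primitive a b e alpha beta U V)
    ((b - a) * (t - e) ^+ 2 / 2 * (alpha + beta * (t * U + (1 - t) * V))).
Proof.
move=> ab /=; have ba0 : b - a != 0 by rewrite subr_eq0 gt_eqF.
rewrite /majorant_primitive /=; apply: is_derive_eq; rewrite /GRing.scale /=.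
by field.
Qed.

(** Twelve times the integrals over [0, y] of (t - c)^2 t and (t - c)^2 (1 - t).
    In algebraic form each is a quadratic in c with negative discriminant, and
    the completed squares below exhibit this. *)
Lemma weighted_moments_gt0 (R : realType) (c y : R) : 0 < y -> y < 1 ->
  let A := (y - c) ^+ 3 - (0 - c) ^+ 3 in
  let m := (y - c) ^+ 3 * (3 * y + c) - (0 - c) ^+ 3 * (3 * 0 + c) in
  0 < m /\ 0 < 4 * A - m.
Proof.
move=> y0 y1 A m; split.
  have -> : m = y ^+ 2 * (6 * (c - 2 / 3 * y) ^+ 2 + y ^+ 2 / 3) by rewrite /m; field.
  by rewrite mulr_gt0 ?exprn_gt0// ltr_wpDl ?divr_gt0 ?exprn_gt0// mulr_ge0 ?sqr_ge0.
have y2 : 0 < 2 - y by lra.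
have -> : 4 * A - m = y / (6 * (2 - y)) *
    ((6 * (2 - y) * c - y * (6 - 4 * y)) ^+ 2 + y ^+ 2 * (12 * (1 - y) + 2 * y ^+ 2)).
  by rewrite /A /m; field; rewrite gt_eqF.
rewrite mulr_gt0 ?divr_gt0 ?mulr_gt0// ltr_wpDl ?sqr_ge0//.
by rewrite mulr_gt0 ?exprn_gt0// addr_gt0// mulr_gt0 ?exprn_gt0// subr_gt0.
Qed.

(** The bound for one half of the kernel.  Positivity of the moments m and n is
    what makes B = 0 force U = V = 0: in that case f'' vanishes on the segment
    and the constant line 0 replaces the tangent, which B / A = 0 does not
    provide. *)
Lemma peano_piece_le (R : realType) (f F : R -> R) (a b e p1 p2 q U V : R) :
  let A := (p2 - e) ^+ 3 - (p1 - e) ^+ 3 in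
  let m := (p2 - e) ^+ 3 * (3 * p2 + e) - (p1 - e) ^+ 3 * (3 * p1 + e) in
  let n := 4 * A - m in
  a < b -> 0 <= p1 -> p1 <= p2 -> p2 <= 1 -> 1 <= q -> 0 < m -> 0 < n ->
  (forall x, x \in `[a, b] -> is_derive x 1 F (f x)) ->
  (forall x, x \in `[a, b] -> derivable f x 1) ->
  (forall x, x \in `[a, b] -> derivable (derive1 f) x 1) ->
  0 <= U -> 0 <= V ->
  (forall t : R, 0 <= t <= 1 ->
     `|derive1n 2 f (t * a + (1 - t) * b)| `^ q <= t * U + (1 - t) * V) ->
  `| peano_primitive f F a b e (p1 * a + (1 - p1) * b)
     - peano_primitive f F a b e (p2 * a + (1 - p2) * b) | <=
  (b - a) ^+ 2 / 6 * (A `^ (1 - 1 / q) * ((m * U + n * V) / 4) `^ (1 / q)).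
Proof.
move=> A m n ab p10 p12 p21 q1 m0 n0 dF df df' U0 V0 conv.
have q0 : 0 < q by exact: lt_le_trans q1.
have r0 : 0 < 1 / q by rewrite divr_gt0.
have r1 : 1 / q <= 1 by rewrite ler_pdivrMr// mul1r.
have ba0 : b - a != 0 by rewrite subr_eq0 gt_eqF.
have A0 : 0 < A by rewrite /n in n0; lra.
set B := (m * U + n * V) / 4.
have mU : 0 <= m * U by rewrite mulr_ge0// ltW.
have nV : 0 <= n * V by rewrite mulr_ge0// ltW.
have B0 : 0 <= B by rewrite divr_ge0// addr_ge0.
have [alpha [beta [hd2 ABE]]] : exists alpha beta : R,
    (forall t : R, 0 <= t <= 1 ->
      `|derive1n 2 f (t * a + (1 - t) * b)| <= alpha + beta * (t * U + (1 - t) * V)) /\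
    A * alpha + beta * B = A `^ (1 - 1 / q) * B `^ (1 / q).
  have rootq z : 0 <= z -> (z `^ q) `^ (1 / q) = z.
    by move=> z0; rewrite -powRrM div1r divff ?gt_eqF// powRr1.
  move: B0; rewrite le_eqVlt => /predU1P[/esym BE|B0].
    exists 0, 0; split; last by rewrite BE powR0 ?gt_eqF// !mulr0 addr0.
    have mnUV : m * U + n * V = 0 by move: BE; rewrite /B; lra.
    have U00 : U = 0.
      have /eqP : m * U = 0 by lra.
      by rewrite mulf_eq0 gt_eqF//= => /eqP.
    have V00 : V = 0.
      have /eqP : n * V = 0 by lra.
      by rewrite mulf_eq0 gt_eqF//= => /eqP.
    move=> t /conv; rewrite U00 V00 !mulr0 addr0 => h.
    rewrite -[leLHS]rootq ?normr_ge0//.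
    have -> : `|derive1n 2 f (t * a + (1 - t) * b)| `^ q = 0.
      by apply/le_anti; rewrite h powR_ge0.
    by rewrite powR0 ?gt_eqF// addr0.
  have [alpha [beta [b0 tang ABE]]] := holder_by_tangent _ _ _ _ r0 r1 A0 B0.
  exists alpha, beta; split => // t t01.
  rewrite -[leLHS]rootq ?normr_ge0//.
  apply: (le_trans (tang _ (powR_ge0 _ _))).
  by rewrite lerD2l ler_wpM2l// conv.
rewrite -ABE.
(* The larger parameter gives the smaller point, since t decreases in x. *)
set u := p2 * a + (1 - p2) * b; set v := p1 * a + (1 - p1) * b.
have uE : u = b - p2 * (b - a) by rewrite /u; ring.
have vE : v = b - p1 * (b - a) by rewrite /v; ring.
have abge0 : 0 <= b - a by rewrite subr_ge0 ltW.
have uv : u <= v by rewrite uE vE lerD2l lerN2 ler_wpM2r.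
have au : a <= u.
  by have : p2 * (b - a) <= 1 * (b - a) by [rewrite ler_wpM2r]; rewrite uE; lra.
have vb : v <= b by rewrite vE gerBl mulr_ge0.
have inab x : x \in `[u, v] -> x \in `[a, b].
  by rewrite !in_itv/= => /andP[ux xv]; rewrite (le_trans au ux) (le_trans xv vb).
have dpsi x : x \in `[u, v] -> is_derive x 1 (peano_primitive f F a b e)
    (- ((b - a) * ((b - x) / (b - a) - e) ^+ 2 / 2 * derive1n 2 f x)).
  move=> /inab xab.
  by apply: is_derive_peano_primitive => //; [exact: dF|exact: df|exact: df'].
have dG (x : R) := @is_derive_majorant_primitive R a b e alpha beta U V x ab.
apply: (le_trans (norm_increment_le _ _ _ _ _ _ _ uv dpsi (fun x _ => dG x) _)).
  move=> x xuv; rewrite normrN normrM.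
  have : x \in `[a, b] by apply: inab; exact: (subset_itv_oo_cc xuv).
  rewrite in_itv/= => /andP[ax xb].
  set t := (b - x) / (b - a).
  have tx : t * a + (1 - t) * b = x by rewrite /t; field.
  have k0 : 0 <= (b - a) * (t - e) ^+ 2 / 2 by rewrite divr_ge0// mulr_ge0// sqr_ge0.
  rewrite ger0_norm//; apply: ler_wpM2l => //.
  have := hd2 t; rewrite tx; apply.
  apply/andP; split; first by rewrite divr_ge0// subr_ge0.
  by rewrite /t ler_pdivrMr ?subr_gt0// mul1r lerD2l lerN2.
rewrite /majorant_primitive.
have -> : (b - v) / (b - a) = p1 by rewrite vE; field.
have -> : (b - u) / (b - a) = p2 by rewrite uE; field.
rewrite le_eqVlt; apply/orP; left; apply/eqP; rewrite /B /n /m /A /=.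
by field.
Qed.

(** * Antiderivatives on a segment inside an open interval *)

Lemma subset_interior_interval (R : realType) (I : set R) (a b : R) :
  is_interval I -> interior I a -> interior I b -> `[a, b] `<=` interior I.
Proof.
move=> hI ha hb x; rewrite /= in_itv/= => /andP[].
rewrite le_eqVlt => /predU1P[<-//|ax]; rewrite le_eqVlt => /predU1P[->//|xb].
have sub : `]a, b[ `<=` interior I.
  rewrite -open_subsetE; last exact: interval_open.
  move=> z; rewrite /= in_itv/= => /andP[az zb].
  by apply: (hI a b); [exact: interior_subset|exact: interior_subset|rewrite !ltW].
by apply: sub; rewrite /= in_itv/= ax xb.
Qed.

(** The margin on both sides of the segment makes an antiderivative based at a'
    differentiable at the endpoints a and b too. *)
Lemma interior_segment_widen (R : realType) (I : set R) (a b : R) :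
  is_interval I -> interior I a -> interior I b ->
  exists a' b', [/\ a' < a, b < b' & `[a', b'] `<=` interior I].
Proof.
move=> hI ha hb.
have [ra /= ra0 Ba] : nbhs_ball a (interior I).
  by apply/nbhs_ballP; exact: open_nbhs_nbhs (conj (open_interior I) ha).
have [rb /= rb0 Bb] : nbhs_ball b (interior I).
  by apply/nbhs_ballP; exact: open_nbhs_nbhs (conj (open_interior I) hb).
exists (a - ra / 2), (b + rb / 2); split; [lra|lra|].
apply: subset_interior_interval => //.
  by apply: Ba; rewrite /ball/= subKr gtr0_norm; lra.
by apply: Bb; rewrite /ball/= opprD addNKr normrN gtr0_norm; lra.
Qed.

Lemma antiderivative_on_segment (R : realType) (f : R -> R) (a' a b b' : R) :
  a' < a -> a < b -> b < b' ->
  (forall x, x \in `[a', b'] -> {for x, continuous f}) ->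
  exists F : R -> R, (forall x, x \in `[a, b] -> is_derive x 1 F (f x)) /\
    \int[@lebesgue_measure R]_(x in `[a, b]) f x = F b - F a.
Proof.
move=> aa ab bb cf.
have intf u v : a' <= u -> v <= b' ->
    (@lebesgue_measure R).-integrable `[u, v] (EFin \o f).
  move=> au vb; apply: continuous_compact_integrable; first exact: segment_compact.
  apply: continuous_in_subspaceT => x; rewrite inE /= in_itv /= => /andP[ux xv].
  by apply: cf; rewrite in_itv/= (le_trans au ux) (le_trans xv vb).
pose F x := \int[@lebesgue_measure R]_(t in `[a', x]) f t.
have dF x : x \in `[a, b] -> is_derive x 1 F (f x).
  rewrite in_itv/= => /andP[ax xb].
  have xb' : x < b' by exact: le_lt_trans bb.
  have a'x : a' < x by exact: lt_le_trans ax.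
  have cx : {for x, continuous f} by apply: cf; rewrite in_itv/= !ltW.
  have [dx <-] := @continuous_FTC1_closed R f a' x b' xb' (intf _ _ (lexx _) (lexx _)) a'x cx.
  by rewrite derive1E; exact: derivableP.
exists F; split => //.
rewrite /F Rintegral_itvB ?bnd_simp.
- rewrite Rintegral_itv_obnd_cbnd//.
  apply: (integrableS _ _ _ (intf a b _ _)) => //.
  + exact: subset_itv_oc_cc.
  + exact: ltW.
  + exact: ltW.
- by apply: intf => //; exact: ltW.
- exact: ltW.
- exact: ltW.
Qed.

(** * The perturbed trapezoid-midpoint inequality *)

(* MathComp world (MathComp-Analysis) *)
Theorem theorem10 (R : realType) (I : set R) (f : R -> R) (a b c y d q : R)
  (hI : is_interval I)
  (hf : forall x : R, interior I x -> derivable f x 1)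
  (hf' : forall x : R, interior I x -> derivable (derive1 f) x 1)
  (ha : interior I a) (hb : interior I b) (hab : a < b)
  (hL1 : (@lebesgue_measure R).-integrable `[a, b] (EFin \o derive1n 2 f))
  (hc : 0 <= c) (hcy : c <= y) (hyd : y <= d) (hd : d <= 1)
  (hy0 : 0 < y) (hy1 : y < 1) (hq : 1 <= q)
  (hconv : @convex_function R R^o `[a, b] (fun x : R => `|derive1n 2 f x| `^ q)) :
  let M : R := c ^+ 4 - (c - y) ^+ 3 * (c + 3 * y) in
  let N : R := 4 * c ^+ 3 - c ^+ 4 + (c - y) ^+ 3 * (c + 3 * y - 4) in
  let P : R := (d - y) ^+ 3 * (d + 3 * y) - (d - 1) ^+ 3 * (d + 3) in
  let Q : R := (d - y) ^+ 3 * (4 - d - 3 * y) + (d - 1) ^+ 4 in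
  let inv_p : R := 1 - 1 / q in
  `| ((c - y) ^+ 2 - (d - y) ^+ 2) / 2 * (a - b)
       * derive1 f (y * a + (1 - y) * b)
     + ((d - 1) ^+ 2 * derive1 f a - c ^+ 2 * derive1 f b) / 2 * (a - b)
     + (c - d) * f (y * a + (1 - y) * b)
     + ((d - 1) * f a - c * f b)
     + 1 / (b - a) * \int[@lebesgue_measure R]_(x in `[a, b]) f x |
  <= (b - a) ^+ 2 / 6 *
     ( (c ^+ 3 - (c - y) ^+ 3) `^ inv_p
         * ((M * `|derive1n 2 f a| `^ q + N * `|derive1n 2 f b| `^ q) / 4) `^ (1 / q)
     + ((d - y) ^+ 3 - (d - 1) ^+ 3) `^ inv_p
         * ((P * `|derive1n 2 f a| `^ q + Q * `|derive1n 2 f b| `^ q) / 4) `^ (1 / q) ).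
Proof.
cbv zeta.
set M := c ^+ 4 - _; set N := 4 * c ^+ 3 - _ + _.
set P := _ - (d - 1) ^+ 3 * (d + 3); set Q := _ + (d - 1) ^+ 4.
have ba0 : b - a != 0 by rewrite subr_eq0 gt_eqF.
have [a' [b' [a'a bb' subI]]] := interior_segment_widen _ _ _ _ hI ha hb.
have abI x : x \in `[a, b] -> interior I x.
  move=> xab; apply: subI; rewrite /= in_itv/=; move: xab.
  rewrite in_itv/= => /andP[ax xb].
  by rewrite (le_trans (ltW a'a)) ?(le_trans xb (ltW bb')).
have [F [dF intF]] : exists F : R -> R,
    (forall x, x \in `[a, b] -> is_derive x 1 F (f x)) /\
    \int[@lebesgue_measure R]_(x in `[a, b]) f x = F b - F a.
  apply: (antiderivative_on_segment _ _ a' _ _ b') => // x xab.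
  by apply: differentiable_continuous; apply/derivable1_diffP; apply: hf; exact: subI.
set U := `|derive1n 2 f a| `^ q; set V := `|derive1n 2 f b| `^ q.
have conv (t : R) : 0 <= t <= 1 ->
    `|derive1n 2 f (t * a + (1 - t) * b)| `^ q <= t * U + (1 - t) * V.
  move=> /andP[t0 t1]; have := hconv (Itv01 t0 t1) a b.
  by rewrite !convRE /=; apply; rewrite inE /= in_itv/= lexx ltW.
have piece := fun e p1 p2 p10 p12 p21 m0 n0 =>
  peano_piece_le R f F a b e p1 p2 q U V hab p10 p12 p21 hq m0 n0 dF
    (fun x xab => hf x (abI x xab)) (fun x xab => hf' x (abI x xab))
    (powR_ge0 _ _) (powR_ge0 _ _) conv.
have [mc0 nc0] := weighted_moments_gt0 R c y hy0 hy1.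
(* The reflection t -> 1 - t exchanges the two moments and turns the kernel of
   node d on [y, 1] into the kernel of node 1 - d on [0, 1 - y]. *)
have [md0 nd0] : let A := (1 - d) ^+ 3 - (y - d) ^+ 3 in
    let m := (1 - d) ^+ 3 * (3 * 1 + d) - (y - d) ^+ 3 * (3 * y + d) in
    0 < m /\ 0 < 4 * A - m.
  have y1 : 0 < 1 - y by rewrite subr_gt0.
  have y1' : 1 - y < 1 by rewrite gtrBl.
  have [m0 n0] := weighted_moments_gt0 R (1 - d) (1 - y) y1 y1'.
  split; [move: n0|move: m0]; apply: eq_ind; congr (0 < _); ring.
have := piece c 0 y (lexx 0) (ltW hy0) (ltW hy1) mc0 nc0.
have := piece d y 1 (ltW hy0) (ltW hy1) (lexx 1) md0 nd0.
have -> : 0 * a + (1 - 0) * b = b by ring.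
have -> : 1 * a + (1 - 1) * b = a by ring.
set z := y * a + (1 - y) * b.
have -> : (1 - d) ^+ 3 - (y - d) ^+ 3 = (d - y) ^+ 3 - (d - 1) ^+ 3 by ring.
have -> : (y - c) ^+ 3 - (0 - c) ^+ 3 = c ^+ 3 - (c - y) ^+ 3 by ring.
have -> : (y - c) ^+ 3 * (3 * y + c) - (0 - c) ^+ 3 * (3 * 0 + c) = M
  by rewrite /M; ring.
have -> : (1 - d) ^+ 3 * (3 * 1 + d) - (y - d) ^+ 3 * (3 * y + d) = P
  by rewrite /P; ring.
have -> : 4 * (c ^+ 3 - (c - y) ^+ 3) - M = N by rewrite /N /M; ring.
have -> : 4 * ((d - y) ^+ 3 - (d - 1) ^+ 3) - P = Q by rewrite /P /Q; ring.
rewrite distrC => hd2; rewrite distrC => hc2; rewrite [leRHS]mulrDr.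
apply: (le_trans _ (lerD hc2 hd2)).
apply: le_trans (ler_normD _ _).
rewrite intF le_eqVlt; apply/orP; left; apply/eqP; congr (`| _ |).
rewrite /peano_primitive.
have -> : (b - z) / (b - a) = y by rewrite /z; field.
have -> : (b - a) / (b - a) = 1 by rewrite divff.
have -> : (b - b) / (b - a) = 0 by rewrite subrr mul0r.
by field.
Qed.
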